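(* Let $y^{[0]},z^{[0]}$ be the predictor values $$y^{[0]}=y^n+\Delta t\,z^n+\frac{\Delta t^2}{2\varepsilon}g(y^n,z^n),\qquad z^{[0]}=z^n+\frac{\Delta t}{\varepsilon}g(y^{[0]},z^{[0]})-\frac{\Delta t^2}{2\varepsilon}\dot g(y^{[0]},z^{[0]}).$$ Assume that $y^{[0]}$ and $z^{[0]}$ possess Hilbert expansions in $\varepsilon$, operating under the assumptions (A1)–(A4) listed in the context. Then $y^{[0]}$ and $z^{[0]}$ are also well-prepared, i.e., with $g^{[0]}_{(0)}:=g\left(y^{[0]}_{(0)},z^{[0]}_{(0)}\right)$ and $\nabla g^{[0]}_{(0)}:=\nabla g\left(y^{[0]}_{(0)},z^{[0]}_{(0)}\right)$, $$g^{[0]}_{(0)}=0,\qquad \nabla g^{[0]}_{(0)}\cdot\begin{pmatrix} z^{[0]}_{(0)}\\ \nabla g^{[0]}_{(0)}\cdot\begin{pmatrix} y^{[0]}_{(1)}\\ z^{[0]}_{(1)}\end{pmatrix}\end{pmatrix}=0.$$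
   Context: Setting: $g:\mathbb{R}^2\to\mathbb{R}$ is smooth, $0<\varepsilon\ll1$; the scheme approximates $y'=z$, $z'=\frac{1}{\varepsilon}g(y,z)$, and $(y^n,z^n)$ is the given numerical solution at time $t^n$, with step size $\Delta t$. Define $\nabla g=(\partial_y g,\partial_z g)$ and $\dot g(y,z):=\nabla g(y,z)\cdot\begin{pmatrix} z\\ \frac{1}{\varepsilon}g(y,z)\end{pmatrix}$. Standing assumption: there is $c>0$ with $\partial_z g(y,z)<-c$ for all $y,z\in\mathbb{R}$. Assumptions: (A1) There are constants $L_g,L_{\dot g}$ independent of $\varepsilon$ with $|g(y_1,z_1)-g(y_2,z_2)|\le L_g\|(y_1-y_2,z_1-z_2)\|$ and $|\dot g(y_1,z_1)-\dot g(y_2,z_2)|\le \frac{L_{\dot g}}{\varepsilon}\|(y_1-y_2,z_1-z_2)\|$. (A2) For all $y,z_1,z_2\in\mathbb{R}$: $|\partial_z g(y,z_1)-\partial_z g(y,z_2)|\le L_{\partial_z g}|z_1-z_2|$ and $|\partial_z\dot g(y,z_1)-\partial_z\dot g(y,z_2)|\le\frac{L_{\partial_z\dot g}}{\varepsilon}|z_1-z_2|$; moreover all occurring derivatives of $g$ are uniformly bounded. (A3) $g(y^n,z^n)=\mathcal{O}(\varepsilon\Delta t)$ and $\dot g(y^n,z^n)=\mathcal{O}\left(\frac{\Delta t}{\varepsilon}\right)$. (A4) $y^n$ and $z^n$ possess Hilbert expansions. Hilbert expansion: an $\varepsilon$-dependent quantity $u$ possesses a Hilbert expansion if there are unique $\varepsilon$-independent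 coefficients $u_{(0)},u_{(1)},u_{(2)},\dots$ with $u=u_{(0)}+\varepsilon u_{(1)}+\varepsilon^2u_{(2)}+\cdots$ as $\varepsilon\to0$ (asymptotic expansion, $\Delta t$ held fixed); a subscript $(j)$ denotes the $j$-th coefficient. *)

(* Defs.v *)
From HB Require Import structures.
From mathcomp Require Import all_boot all_order all_algebra.
From mathcomp Require Import all_classical all_reals all_analysis.
Set Implicit Arguments.
Unset Strict Implicit.
Unset Printing Implicit Defensive.
Import Order.TTheory GRing.Theory Num.Theory.
Import numFieldNormedType.Exports.
Local Open Scope classical_set_scope.
Local Open Scope ring_scope.

(* Euclidean norm on the plane; the library norm on [R * R] is the max norm. *)
Definition enorm (R : realType) (p : R * R) : R :=
  Num.sqrt (p.1 ^+ 2 + p.2 ^+ 2).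

Definition dy (R : realType) (g : R * R -> R) : R * R -> R :=
  fun p => 'D_((1, 0) : R * R) g p.

Definition dz (R : realType) (g : R * R -> R) : R * R -> R :=
  fun p => 'D_((0, 1) : R * R) g p.

Definition grad (R : realType) (g : R * R -> R) (p : R * R) : R * R :=
  (dy g p, dz g p).

Definition dot (R : realType) (u v : R * R) : R := u.1 * v.1 + u.2 * v.2.

(* [false] stands for d/dy and [true] for d/dz; the head of the list is
   applied last. *)
Definition iter_partial (R : realType) (s : seq bool) (g : R * R -> R) :
    R * R -> R :=
  foldr (fun b f => if b then dz f else dy f) g s.

(* 'D_v is a total operator with a junk value where the derivative does not
   exist. Fréchet differentiability of the iterated partials of every order
   ensures that all of them exist and are continuous. *)
Definition smooth (R : realType) (g : R * R -> R) : Prop :=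
  forall (s : seq bool) (p : R * R), differentiable (iter_partial s g) p.

(* Derivative of g along the flow of y' = z, z' = g(y,z) / eps. *)
Definition gdot (R : realType) (g : R * R -> R) (eps : R) (p : R * R) : R :=
  dot (grad g p) (p.2, eps^-1 * g p).

(* Asymptotic power series as eps tends to 0 from the right: only the values
   of [u] at small positive arguments matter. *)
Definition hilbert_expansion (R : realType) (u : R -> R) (a : nat -> R) : Prop :=
  forall N : nat,
    (fun eps : R => u eps - \sum_(j < N.+1) a j * eps ^+ j)
      =o_ (0^'+) (fun eps : R => eps ^+ N).

Definition has_hilbert_expansion (R : realType) (u : R -> R) : Prop :=
  exists! a : nat -> R, hilbert_expansion u a.

(* Meaningful only under [has_hilbert_expansion u], where it is the unique
   coefficient sequence. *)
Definition hilbert_coef (R : realType) (u : R -> R) : nat -> R :=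
  xget (fun=> 0) [set a | hilbert_expansion u a].

(* Main.v *)
Require Import Defs.
From HB Require Import structures.
From mathcomp Require Import all_boot all_order all_algebra.
From mathcomp Require Import all_classical all_reals all_analysis.
From mathcomp Require Import ring.
Set Implicit Arguments.
Unset Strict Implicit.
Unset Printing Implicit Defensive.
Import Order.TTheory GRing.Theory Num.Theory.
Import numFieldNormedType.Exports.
Local Open Scope classical_set_scope.
Local Open Scope ring_scope.

(* The residual of the equation for z^[0], multiplied by eps^2, vanishes and
   tends to dt^2/2 * d_z g(p0) * g(p0), so g(p0) = 0 because d_z g < 0.
   Then g(y^[0], z^[0]) / eps tends to grad g(p0) . p1, and the limit of the
   residual multiplied by eps only is dt^2/2 times the second expression. *)

Section right_expansions.
Context {R : realType}.

Lemma cvg_id_at_right0 : eps @[eps --> (0 : R)^'+] --> (0 : R).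
Proof. by apply: cvg_at_right_filter; exact: cvg_id. Qed.

(** Chain rule along a one-sided curve leaving [p] with velocity [v]. The increment of [g] is
    ['d g p (w eps - p)] plus a remainder of order o(|w eps - p|). After division by [eps], the
    linear part converges by continuity of the differential, and the remainder tends to 0 because
    the quotient of [w] stays bounded. *)
Lemma cvg_diff_quotient (V W : normedModType R) (g : V -> W) (p v : V)
    (w : R -> V) :
  differentiable g p ->
  eps^-1 *: (w eps - p) @[eps --> 0^'+] --> v ->
  eps^-1 *: (g (w eps) - g p) @[eps --> 0^'+] --> 'd g p v.
Proof.
move=> dg wv.
have eps0 := cvg_id_at_right0.
(* The increment is [eps] times its convergent quotient, hence tends to 0 * v. *)
have wp0 : w eps - p @[eps --> (0 : R)^'+] --> (0 : V).
  rewrite -(scale0r v); apply: cvg_trans (cvgZ eps0 wv).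
  apply: near_eq_cvg; near=> eps.
  rewrite scalerA divff ?scale1r// gt_eqF//; near: eps; exact: nbhs_right_gt.
pose r h := g (h + p) - g p - 'd g p h.
have rP : forall e, 0 < e -> \forall h \near (0 : V), `|r h| <= e * `|h|.
  have /eqaddoP ro := diff_locally dg.
  move=> e e0; have := ro _ e0; apply: filterS => h.
  by rewrite /r !fctE /= opprD addrA.
have dgv : 'd g p (eps^-1 *: (w eps - p)) @[eps --> (0 : R)^'+] --> 'd g p v.
  by apply: continuous_cvg wv; exact: diff_continuous.
rewrite -[X in _ --> X]addr0.
have rem0 : eps^-1 *: r (w eps - p) @[eps --> (0 : R)^'+] --> (0 : W).
  apply/cvgr0Pnorm_le => e e0.
  (* The quotient is eventually bounded by |v| + 1, so the remainder estimate is taken with constant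
     e / (|v| + 1) and the product of the two bounds is e. *)
  have K0 : 0 < `|v| + 1 by rewrite ltr_wpDl.
  have wK : \forall eps \near (0 : R)^'+,
      `|eps^-1 *: (w eps - p)| <= `|v| + 1.
    by apply: (cvgr_norm_le _ wv); rewrite ltrDl.
  have rK := wp0 _ (rP _ (divr_gt0 e0 K0)).
  near=> eps.
  have h1 : `|eps^-1 *: (w eps - p)| <= `|v| + 1 by near: eps; exact: wK.
  have h2 : `|r (w eps - p)| <= e / (`|v| + 1) * `|w eps - p|.
    by near: eps; exact: rK.
  rewrite normrZ (le_trans (ler_wpM2l _ h2))//.
  rewrite mulrCA -normrZ (le_trans (ler_wpM2l _ h1)) ?divfK ?gt_eqF//.
  by rewrite ltW// divr_gt0.
apply: cvg_trans (cvgD dgv rem0).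
apply: near_eq_cvg; near=> eps; rewrite fctE /=.
by rewrite linearZ -scalerDr /r addrC subrK subrK.
Unshelve. all: by end_near. Qed.

Lemma diff_dot (g : R * R -> R) (p v : R * R) :
  differentiable g p -> 'd g p v = dot (grad g p) v.
Proof.
move=> dg; rewrite /dot /grad /dy /dz /= !deriveE//.
have {1}-> : v = v.1 *: (1, 0) + v.2 *: (0, 1).
  rewrite -[RHS]/(v.1 * 1 + v.2 * 0, v.1 * 0 + v.2 * 1).
  by rewrite !mulr1 !mulr0 addr0 add0r -surjective_pairing.
by rewrite linearD !linearZ /= mulrC [X in _ + X]mulrC.
Qed.

Lemma hilbert_coefP (u : R -> R) :
  has_hilbert_expansion u -> hilbert_expansion u (hilbert_coef u).
Proof. by move=> [a [au _]]; apply: (xgetPex (fun=> 0)); exists a. Qed.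

Lemma hilbert_expansion_cvg0 (u : R -> R) (a : nat -> R) :
  hilbert_expansion u a -> u eps @[eps --> 0^'+] --> a 0%N.
Proof.
move=> /(_ 0%N)/eqoP ua; apply/cvgrPdist_le => e e0.
apply: filterS (ua _ e0) => eps.
by rewrite /= big_ord_recr big_ord0 /= expr0 normr1 !mulr1 add0r distrC.
Qed.

(** The expansion truncated after the linear term has error o(eps); dividing by [eps] leaves the
    first coefficient. This supplies the velocity for [cvg_diff_quotient]. *)
Lemma hilbert_expansion_cvg1 (u : R -> R) (a : nat -> R) :
  hilbert_expansion u a ->
  eps^-1 *: (u eps - a 0%N) @[eps --> 0^'+] --> a 1%N.
Proof.
move=> /(_ 1%N)/eqoP ua; apply/cvgrPdist_le => e e0.
near=> eps.
have eps0 : 0 < eps by near: eps; exact: nbhs_right_gt.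
have : `|u eps - \sum_(j < 2) a j * eps ^+ j| <= e * `|eps ^+ 1|.
  by near: eps; exact: ua.
rewrite !big_ord_recr big_ord0 /= expr0 add0r mulr1 expr1.
rewrite (gtr0_norm eps0) -ler_pdivrMr// -[X in _ / X](gtr0_norm eps0) -normf_div.
rewrite distrC; congr (`|_| <= _); rewrite /GRing.scale /=.
by field; rewrite gt_eqF.
Unshelve. all: by end_near. Qed.

Lemma cvg_pair_prod (f h : R -> R) (a b : R) :
  f eps @[eps --> 0^'+] --> a -> h eps @[eps --> 0^'+] --> b ->
  (f eps, h eps) @[eps --> 0^'+] --> ((a, b) : R * R).
Proof. move=> fa hb; exact: (cvg_pair fa hb). Qed.

End right_expansions.

Theorem lemma4 (R : realType) (g : R * R -> R)
  (c Lg Lgdot Ldzg Ldzgdot B Cg Cgdot : R)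
  (* admissible step sizes; numerical data as functions of dt and eps *)
  (D : set R) (yn zn : R -> R -> R)
  (g_smooth : smooth g)
  (D_pos : forall dt : R, D dt -> 0 < dt)
  (c_pos : 0 < c)
  (dz_lt : forall y z : R, dz g (y, z) < - c)
  (A1_g : forall y1 z1 y2 z2 : R,
    `|g (y1, z1) - g (y2, z2)| <= Lg * enorm (y1 - y2, z1 - z2))
  (A1_gdot : \forall eps \near 0^'+, forall y1 z1 y2 z2 : R,
    `|gdot g eps (y1, z1) - gdot g eps (y2, z2)|
      <= Lgdot / eps * enorm (y1 - y2, z1 - z2))
  (A2_dzg : forall y z1 z2 : R,
    `|dz g (y, z1) - dz g (y, z2)| <= Ldzg * `|z1 - z2|)
  (A2_dzgdot : \forall eps \near 0^'+, forall y z1 z2 : R,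
    `|dz (gdot g eps) (y, z1) - dz (gdot g eps) (y, z2)|
      <= Ldzgdot / eps * `|z1 - z2|)
  (A2_bounded : forall s : seq bool, (0 < size s <= 2)%N ->
    forall p : R * R, `|iter_partial s g p| <= B)
  (A3_g : forall dt : R, D dt -> \forall eps \near 0^'+,
    `|g (yn dt eps, zn dt eps)| <= Cg * (eps * dt))
  (A3_gdot : forall dt : R, D dt -> \forall eps \near 0^'+,
    `|gdot g eps (yn dt eps, zn dt eps)| <= Cgdot * (dt / eps))
  (A4_y : forall dt : R, D dt -> has_hilbert_expansion (yn dt))
  (A4_z : forall dt : R, D dt -> has_hilbert_expansion (zn dt))
  (dt : R) (D_dt : D dt) (y0 z0 : R -> R)
  (y0_def : \forall eps \near 0^'+,
    y0 eps = yn dt eps + dt * zn dt eps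
             + dt ^+ 2 / (2 * eps) * g (yn dt eps, zn dt eps))
  (z0_def : \forall eps \near 0^'+,
    z0 eps = zn dt eps + dt / eps * g (y0 eps, z0 eps)
             - dt ^+ 2 / (2 * eps) * gdot g eps (y0 eps, z0 eps))
  (y0_hilbert : has_hilbert_expansion y0)
  (z0_hilbert : has_hilbert_expansion z0) :
  let p0 := (hilbert_coef y0 0%N, hilbert_coef z0 0%N) in
  let p1 := (hilbert_coef y0 1%N, hilbert_coef z0 1%N) in
  g p0 = 0 /\ dot (grad g p0) (p0.2, dot (grad g p0) p1) = 0.
Proof.
move=> p0 p1.
have y0E := hilbert_coefP y0_hilbert.
have z0E := hilbert_coefP z0_hilbert.
have znE := hilbert_coefP (A4_z _ D_dt).
have eps0 : eps @[eps --> (0 : R)^'+] --> (0 : R) := cvg_id_at_right0.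
have z0_cvg := hilbert_expansion_cvg0 z0E.
have zn_cvg := hilbert_expansion_cvg0 znE.
have w_cvg : (y0 eps, z0 eps) @[eps --> 0^'+] --> p0.
  exact: cvg_pair_prod (hilbert_expansion_cvg0 y0E) z0_cvg.
(* Smoothness makes every iterated partial continuous at [p0]; the lists [[::]], [[:: false]] and
   [[:: true]] give [g], [dy g] and [dz g]. *)
have at_w s : iter_partial s g (y0 eps, z0 eps) @[eps --> 0^'+] -->
    iter_partial s g p0.
  by apply: continuous_cvg w_cvg; apply: differentiable_continuous.
have g_cvg := at_w [::]; have gy_cvg := at_w [:: false].
have gz_cvg := at_w [:: true].
rewrite /= in g_cvg gy_cvg gz_cvg.
have dt2 : dt ^+ 2 / 2 != 0 by rewrite mulf_neq0// sqrf_eq0 gt_eqF// D_pos.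
have scheme : \forall eps \near 0^'+, 0 < eps /\
    z0 eps - zn dt eps = dt / eps * g (y0 eps, z0 eps) -
      dt ^+ 2 / (2 * eps) * gdot g eps (y0 eps, z0 eps).
  near=> eps; split; first by near: eps; exact: nbhs_right_gt.
  by apply/eqP; rewrite subr_eq addrC addrA; apply/eqP; near: eps; exact: z0_def.
(* Both claims follow this pattern: a rescaled residual vanishes for all small positive [eps], so by
   uniqueness of limits its limit is 0. *)
have limit_eq0 (f : R -> R) (l : R) :
    (\forall eps \near 0^'+, 0 = f eps) -> f eps @[eps --> 0^'+] --> l -> l = 0.
  move=> f0 fl; apply: (cvg_unique (@norm_hausdorff _ _) fl).
  exact: cvg_trans (near_eq_cvg f0) (cvg_cst _).
have gp0 : g p0 = 0.
  have gz_neq0 : dz g p0 != 0.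
    by rewrite lt_eqF// (lt_trans (dz_lt _ _))// oppr_lt0.
  (* With [gdot] expanded, the factor eps^2 clears every negative power of [eps], including the
     1/eps inside [gdot]. *)
  pose f eps := eps * eps * (z0 eps - zn dt eps)
    - dt * eps * g (y0 eps, z0 eps)
    + dt ^+ 2 / 2 * (eps * dy g (y0 eps, z0 eps) * z0 eps
                     + dz g (y0 eps, z0 eps) * g (y0 eps, z0 eps)).
  have f0 : \forall eps \near 0^'+, 0 = f eps.
    apply: filterS scheme => eps [e0 zE].
    by rewrite /f zE /gdot /dot /grad /=; field; rewrite gt_eqF.
  suff /(limit_eq0 _ _ f0)/eqP : f eps @[eps --> 0^'+] -->
      dt ^+ 2 / 2 * (dz g p0 * g p0).
    by rewrite mulf_eq0 (negPf dt2) mulf_eq0 (negPf gz_neq0) => /eqP.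
  (* The limit is rewritten in the shape of [f] with [eps] replaced by 0, so that the limit laws
     apply term by term. *)
  have -> : dt ^+ 2 / 2 * (dz g p0 * g p0) =
      0 * 0 * (hilbert_coef z0 0%N - hilbert_coef (zn dt) 0%N)
      - dt * 0 * g p0
      + dt ^+ 2 / 2 * (0 * dy g p0 * hilbert_coef z0 0%N + dz g p0 * g p0).
    by ring.
  apply: cvgD; last first.
    apply: cvgM (cvg_cst _) (cvgD _ (cvgM gz_cvg g_cvg)).
    exact: cvgM (cvgM eps0 gy_cvg) z0_cvg.
  apply: cvgB; last exact: cvgM (cvgM (cvg_cst _) eps0) g_cvg.
  exact: cvgM (cvgM eps0 eps0) (cvgB z0_cvg zn_cvg).
split=> //.
have Dg_cvg : eps^-1 *: g (y0 eps, z0 eps) @[eps --> 0^'+] -->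
    dot (grad g p0) p1.
  rewrite -diff_dot; last exact: (g_smooth [::]).
  (* Since [g p0] = 0, the quotient g / eps is a difference quotient of [g] at [p0]. *)
  under eq_fun do rewrite -[g _]subr0 -gp0.
  apply: cvg_diff_quotient; first exact: (g_smooth [::]).
  exact: cvg_pair_prod (hilbert_expansion_cvg1 y0E) (hilbert_expansion_cvg1 z0E).
(* With a single factor [eps], one 1/eps survives; it stays attached to [g], where [Dg_cvg] gives
   the limit. *)
pose f eps := eps * (z0 eps - zn dt eps) - dt * g (y0 eps, z0 eps)
  + dt ^+ 2 / 2 * (dy g (y0 eps, z0 eps) * z0 eps
                   + dz g (y0 eps, z0 eps) * (eps^-1 *: g (y0 eps, z0 eps))).
have f0 : \forall eps \near 0^'+, 0 = f eps.
  apply: filterS scheme => eps [e0 zE].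
  rewrite /f zE /gdot /dot /grad /GRing.scale /=.
  by field; rewrite gt_eqF.
suff /(limit_eq0 _ _ f0)/eqP : f eps @[eps --> 0^'+] -->
    dt ^+ 2 / 2 * dot (grad g p0) (p0.2, dot (grad g p0) p1).
  by rewrite mulf_eq0 (negPf dt2) => /eqP.
(* The extra term [dt * g p0] on the right is zero by the first claim. *)
have -> : dt ^+ 2 / 2 * dot (grad g p0) (p0.2, dot (grad g p0) p1) =
    0 * (hilbert_coef z0 0%N - hilbert_coef (zn dt) 0%N) - dt * g p0
    + dt ^+ 2 / 2 * (dy g p0 * hilbert_coef z0 0%N
                     + dz g p0 * dot (grad g p0) p1).
  by rewrite gp0 /dot /=; ring.
apply: cvgD; last first.
  by apply: cvgM (cvg_cst _) (cvgD (cvgM gy_cvg z0_cvg) (cvgM gz_cvg Dg_cvg)).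
apply: cvgB; last exact: cvgM (cvg_cst _) g_cvg.
exact: cvgM eps0 (cvgB z0_cvg zn_cvg).
Unshelve. all: by end_near. Qed.
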